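(* For each integer $n\geq 0$ and every $x\in\mathbb{C}$, \[ \sum_{k=0}^{\lfloor n/2\rfloor} \binom{n}{2k} C_{2(n-2k)}(x)\,\bigl(36x^2(9x^2-1)\bigr)^{k} E_{2k} = \sum_{k=0}^n \binom{n}{k} \bigl( C_{2k}(x) - \sqrt{9x^2-1}\,B_{2k}^*(x)\bigr)\bigl(6x\sqrt{9x^2-1}\bigr)^{n-k}, \] where $\sqrt{9x^2-1}$ denotes a fixed square root of $9x^2-1$ (the same one throughout).
   Context: Balancing polynomials $B_n^*(x)$ and Lucas-balancing polynomials $C_n(x)$ are defined by the recurrence $w_n(x)=6x\,w_{n-1}(x)-w_{n-2}(x)$ for $n\geq 2$, with $B_0^*(x)=0$, $B_1^*(x)=1$ and $C_0(x)=1$, $C_1(x)=3x$. Euler numbers $E_n$ are defined by $\sum_{n\geq 0}E_n\frac{z^n}{n!}=\frac{1}{\cosh z}$. *)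

(* Defs.v *)
From HB Require Import structures.
From mathcomp Require Import all_boot all_order all_algebra.
From mathcomp Require Import reals.
From mathcomp.real_closed Require Import complex.

Set Implicit Arguments.
Unset Strict Implicit.
Unset Printing Implicit Defensive.

Import Order.TTheory GRing.Theory Num.Theory.
Local Open Scope ring_scope.

Fixpoint balancing_rec (A : comNzRingType) (w0 w1 : {poly A}) (n : nat)
    : {poly A} :=
  match n with
  | 0 => w0
  | S m => match m with
           | 0 => w1
           | S l => 6%:R *: 'X * balancing_rec w0 w1 m - balancing_rec w0 w1 l
           end
  end.

Definition balancing (A : comNzRingType) (n : nat) : {poly A} :=
  balancing_rec 0 1 n.

Definition lucas_balancing (A : comNzRingType) (n : nat) : {poly A} :=
  balancing_rec 1 (3%:R *: 'X) n.

(* Formal power series over a field, as coefficient sequences. *)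
Definition fps (F : fieldType) := nat -> F.

Definition fps_one (F : fieldType) : fps F := fun n => (n == 0%N)%:R.

Definition fps_mul (F : fieldType) (a b : fps F) : fps F :=
  fun n => \sum_(i < n.+1) a (n - i)%N * b i.

(* The coefficients of degree at most n of 1 / a, for a 0 != 0; see
   fps_mulV below. *)
Fixpoint fps_inv_seq (F : fieldType) (a : fps F) (n : nat) : seq F :=
  match n with
  | 0 => [:: (a 0%N)^-1]
  | S m => let s := fps_inv_seq a m in
           rcons s (- (a 0%N)^-1 * \sum_(i < m.+1) a (m.+1 - i)%N * s`_i)
  end.

Definition fps_inv (F : fieldType) (a : fps F) : fps F :=
  fun n => (fps_inv_seq a n)`_n.

(* cosh z = (exp z + exp (- z)) / 2 *)
Definition fps_cosh (F : fieldType) : fps F :=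
  fun n => ((n`!)%:R^-1 + (-1) ^+ n * (n`!)%:R^-1) / 2%:R.

(* \sum_n E_n z^n / n! = 1 / cosh z, as formal power series over rat. *)
Definition euler_number (n : nat) : rat := (n`!)%:R * fps_inv (@fps_cosh rat) n.

Lemma size_fps_inv_seq (F : fieldType) (a : fps F) n :
  size (fps_inv_seq a n) = n.+1.
Proof. by elim: n => //= n IHn; rewrite size_rcons IHn. Qed.

Lemma nth_fps_inv_seq (F : fieldType) (a : fps F) n i :
  (i <= n)%N -> (fps_inv_seq a n)`_i = fps_inv a i.
Proof.
elim: n => [|n IHn]; first by rewrite leqn0 => /eqP ->.
rewrite leq_eqVlt => /predU1P[-> // | lt_in] /=.
by rewrite nth_rcons size_fps_inv_seq lt_in IHn.
Qed.

Lemma fps_mulV (F : fieldType) (a : fps F) n :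
  a 0%N != 0 -> fps_mul a (fps_inv a) n = fps_one F n.
Proof.
move=> a0; rewrite /fps_mul /fps_one; case: n => [|n].
  by rewrite big_ord1 /fps_inv /= mulfV.
rewrite big_ord_recr /= subnn {2}/fps_inv /= nth_rcons size_fps_inv_seq.
rewrite ltnn eqxx mulNr mulrN mulVKf //; apply/eqP; rewrite subr_eq0.
by apply/eqP/eq_bigr => i _; rewrite nth_fps_inv_seq // -ltnS.
Qed.

Lemma euler_number_egf n :
  fps_mul (@fps_cosh rat) (fun m => euler_number m / (m`!)%:R) n
  = fps_one rat n.
Proof.
rewrite -(@fps_mulV _ (@fps_cosh rat)) //; apply: eq_bigr => i _.
congr (_ * _); rewrite /euler_number mulrAC mulfV ?mul1r //.
by rewrite pnatr_eq0 -lt0n fact_gt0.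
Qed.

(* Main.v *)
Require Import Defs.
From HB Require Import structures.
From mathcomp Require Import all_boot all_order all_algebra.
From mathcomp Require Import reals.
From mathcomp.real_closed Require Import complex.
From mathcomp Require Import ring.

Set Implicit Arguments.
Unset Strict Implicit.
Unset Printing Implicit Defensive.

Import Order.TTheory GRing.Theory Num.Theory.
Local Open Scope ring_scope.

(** Put [a = 3x + s] and [b = 3x - s], so that [a b = 1]; the Binet formulas
    read [2 C_m = a^m + b^m] and [2 s B_m = a^m - b^m].  With [t = 18x^2 - 1]
    and [y = 6xs] one has [a^2 = t + y] and [b^2 = t - y], so the right-hand
    side is [(b^2 + y)^n = t^n].  The left-hand side is the binomial convolution
    of [((t + y)^m + (t - y)^m) / 2] with [y^j E_j], whose exponential generating
    function is [e^(tz) cosh(yz) / cosh(yz) = e^(tz)]. *)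

Lemma big_ord_even (V : nmodType) (f : nat -> V) (n : nat) :
  (forall j, odd j -> f j = 0) ->
  \sum_(k < (n %/ 2).+1) f (2 * k)%N = \sum_(j < n.+1) f j.
Proof.
move=> f_odd; rewrite divn2; elim: n => [|n IHn]; first by rewrite !big_ord1.
rewrite [RHS]big_ord_recr -IHn /= uphalf_half.
(* From [n] to [n.+1] the left sum gains a term exactly when [n] is odd; otherwise the new term on
   the right has odd index and vanishes. *)
have [odd_n|even_n] := boolP (odd n); last by rewrite (f_odd n.+1) ?addr0.
rewrite big_ord_recr /=; congr (_ + f _).
by rewrite mul2n doubleS -[n in RHS]odd_double_half odd_n.
Qed.

Lemma coef_exp_affine (A : comNzRingType) (c y : A) (n j : nat) :
  ((c%:P + y *: 'X) ^+ n)`_j = 'C(n, j)%:R * (c ^+ (n - j) * y ^+ j).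
Proof.
rewrite exprDn coef_sum.
under eq_bigr => i _ do
  rewrite coefMn exprZn -rmorphXn /= -scalerAr coefZ coefCM coefXn.
have [le_jn|lt_nj] := leqP j n; last first.
  rewrite bin_small // mul0r big1 // => i _.
  by rewrite gtn_eqF ?mulr0 ?mul0rn // (leq_ltn_trans _ lt_nj) // -ltnS.
rewrite (bigD1 (inord j)) //= inordK // eqxx mulr1 big1 ?addr0 => [|i ne_ij].
  by rewrite mulr_natl mulrC.
case: eqP => [def_j|_]; last by rewrite !mulr0 mul0rn.
by case/eqP: ne_ij; apply: val_inj; rewrite /= inordK.
Qed.

(* Compares the coefficients of 'X^j in (t + y ('X + a))^n. *)
Lemma bin_mul_exp_shift (A : comNzRingType) (t y a : A) (n j : nat) :
  'C(n, j)%:R * ((t + y * a) ^+ (n - j) * y ^+ j) =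
  \sum_(l < n.+1)
     'C(n, l)%:R * (t ^+ (n - l) * y ^+ l) * ('C(l, j)%:R * a ^+ (l - j)).
Proof.
rewrite -coef_exp_affine.
have -> : (t + y * a)%:P + y *: 'X = t%:P + y *: (a%:P + 1 *: 'X).
  by rewrite scale1r scalerDr addrA polyCD polyCM mul_polyC.
rewrite exprDn coef_sum; apply: eq_bigr => l _.
rewrite coefMn exprZn -rmorphXn /= -scalerAr coefZ coefCM coef_exp_affine.
by rewrite expr1n mulr1 -mulr_natl; ring.
Qed.

(** Compares the coefficients of z^l / l! in (e^z + e^(-z)) (1 / cosh z) = 2. *)
Lemma euler_number_rec (l : nat) :
  \sum_(j < l.+1) 'C(l, j)%:R * (1 + (-1) ^+ (l - j)) * euler_number j
  = (l == 0%N)%:R *+ 2.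
Proof.
have fact_neq0 m : (m`!)%:R != 0 :> rat by rewrite pnatr_eq0 -lt0n fact_gt0.
have -> : (l == 0%N)%:R *+ 2 = (l`!)%:R * 2 * fps_one rat l :> rat.
  by rewrite /fps_one; case: l => [|l] //=; rewrite mulr0 mul0rn.
rewrite -euler_number_egf /fps_mul mulr_sumr; apply: eq_bigr => j _.
have le_jl : (j <= l)%N by rewrite -ltnS.
rewrite /fps_cosh -(bin_fact le_jl) !natrM.
by field; rewrite !fact_neq0.
Qed.

(** Strong induction on the recurrence at odd [l]: for [j < l], odd [j] is covered by induction,
    while even [j] makes [l - j] odd and kills [1 + (-1) ^+ (l - j)]. Only 2 E_l = 0 remains. *)
Lemma euler_number_odd (l : nat) : odd l -> euler_number l = 0.
Proof.
have [m] := ubnP l; elim: m l => // m IHm l; rewrite ltnS => le_lm odd_l.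
have := euler_number_rec l; rewrite big_ord_recr /= big1 => [|j _].
  rewrite add0r binn subnn mul1r gtn_eqF ?odd_gt0 // mul0rn => /eqP.
  by rewrite mulf_eq0 => /orP[|/eqP].
have [odd_j|even_j] := boolP (odd j).
  by rewrite IHm ?mulr0 // (leq_trans (ltn_ord j)).
rewrite -signr_odd oddB ?odd_l ?(negbTE even_j); last exact: ltnW.
by rewrite expr1 subrr mulr0 mul0r.
Qed.

(** Once everything is expanded in the monomials t^(n-l) y^l, the coefficient is 'C(n, l) times the
    sum in [euler_number_rec], so only l = 0 survives. *)
Lemma euler_number_convolution (F : numFieldType) (t y : F) (n : nat) :
  \sum_(j < n.+1) 'C(n, j)%:R * ((t + y) ^+ (n - j) + (t - y) ^+ (n - j))
     * y ^+ j * ratr (euler_number j)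
  = t ^+ n *+ 2.
Proof.
(* The recurrence is transported to [F] and padded to a range independent of [l], so that the two
   sums can be exchanged; the added terms have ['C(l, j) = 0]. *)
have rec l : (l <= n)%N ->
    \sum_(j < n.+1) 'C(l, j)%:R * (1 + (-1) ^+ (l - j))
      * ratr (euler_number j) = (l == 0%N)%:R *+ 2 :> F.
  move=> le_ln; rewrite -(rmorph_nat ratr) -rmorphMn -euler_number_rec rmorph_sum.
  rewrite (big_ord_widen n.+1 (fun j : nat =>
    ratr ('C(l, j)%:R * (1 + (-1) ^+ (l - j)) * euler_number j))) //=.
  rewrite [RHS]big_mkcond /=.
  apply: eq_bigr => j _; case: ltnP => [_|lt_lj].
    rewrite [RHS]rmorphM; congr (_ * _).
    by rewrite rmorphM rmorphD rmorph1 rmorph_sign rmorph_nat.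
  by rewrite bin_small // !mul0r.
under eq_bigr => j _.
  (* Both signs become instances of [bin_mul_exp_shift], at a = 1 and a = -1. *)
  have -> : 'C(n, j)%:R * ((t + y) ^+ (n - j) + (t - y) ^+ (n - j)) * y ^+ j
    = 'C(n, j)%:R * ((t + y * 1) ^+ (n - j) * y ^+ j)
      + 'C(n, j)%:R * ((t + y * -1) ^+ (n - j) * y ^+ j) :> F.
    by rewrite mulr1 mulrN1; ring.
  rewrite !bin_mul_exp_shift -big_split mulr_suml.
  over.
rewrite exchange_big /=.
under eq_bigr => l _.
  under eq_bigr => j _ do
    rewrite -mulrDr -mulrDr expr1n -mulrA.
  rewrite -mulr_sumr rec ?leq_ord //.
  over.
rewrite big_ord_recl big1 /= => [|l _]; last by rewrite mul0rn mulr0.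
by rewrite bin0 subn0 expr0 mulr1 mul1r addr0 mulr_natr.
Qed.

(** A sequence with this recurrence is determined by two consecutive values. The factor [c] is 1 for
    the Lucas-balancing polynomials and [s] for the balancing ones. *)
Lemma horner_balancing_rec (A : comNzRingType) (w0 w1 : {poly A}) (c x : A)
    (u : nat -> A) :
  c * w0.[x] = u 0%N -> c * w1.[x] = u 1%N ->
  (forall m, u m.+2 = 6%:R * x * u m.+1 - u m) ->
  forall m, c * (balancing_rec w0 w1 m).[x] = u m.
Proof.
move=> u0 u1 u_rec m.
suff [] : c * (balancing_rec w0 w1 m).[x] = u m /\
          c * (balancing_rec w0 w1 m.+1).[x] = u m.+1 by [].
elim: m => [|m [IHm IHm1]]; first by [].
split=> //; rewrite u_rec -IHm -IHm1.
rewrite [balancing_rec _ _ m.+2]/= -/(balancing_rec w0 w1 m.+1).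
by rewrite hornerD hornerN -scalerAl hornerZ -commr_polyX hornerMX; ring.
Qed.

Section Binet.

Variables (F : numFieldType) (x s : F).
Hypothesis hs : s ^+ 2 = 9%:R * x ^+ 2 - 1.

(** The hypothesis is the characteristic equation of the recurrence, whose roots are 3x + s and 3x -
    s. *)
Let exp_rec (r : F) m : r ^+ 2 = 6%:R * x * r - 1 ->
  r ^+ m.+2 = 6%:R * x * r ^+ m.+1 - r ^+ m.
Proof. by move=> r2; rewrite -addn2 exprD r2 exprS; ring. Qed.

Let root_add : (3%:R * x + s) ^+ 2 = 6%:R * x * (3%:R * x + s) - 1.
Proof. by rewrite sqrrD hs; ring. Qed.

Let root_sub : (3%:R * x - s) ^+ 2 = 6%:R * x * (3%:R * x - s) - 1.
Proof. by rewrite sqrrB hs; ring. Qed.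

Lemma lucas_balancing_binet m :
  (lucas_balancing F m).[x] = ((3%:R * x + s) ^+ m + (3%:R * x - s) ^+ m) / 2%:R.
Proof.
rewrite -[LHS]mul1r /lucas_balancing; move: m.
apply: horner_balancing_rec => [||m].
- by rewrite !expr0 mul1r hornerC; field.
- by rewrite !expr1 mul1r hornerZ hornerX; field.
- by rewrite (exp_rec m root_add) (exp_rec m root_sub); field.
Qed.

(* Stated as a product since s may vanish. *)
Lemma balancing_binet m :
  s * (balancing F m).[x] = ((3%:R * x + s) ^+ m - (3%:R * x - s) ^+ m) / 2%:R.
Proof.
rewrite /balancing; move: m; apply: horner_balancing_rec => [||m].
- by rewrite !expr0 hornerC; field.
- by rewrite !expr1 hornerC; field.
- by rewrite (exp_rec m root_add) (exp_rec m root_sub); field.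
Qed.

End Binet.

Theorem theorem5 (R : realType) (n : nat) (x s : R[i])
    (hs : s ^+ 2 = 9%:R * x ^+ 2 - 1) :
  \sum_(k < (n %/ 2).+1)
     'C(n, 2 * k)%:R * (lucas_balancing R[i] (2 * (n - 2 * k))).[x]
       * (36%:R * x ^+ 2 * (9%:R * x ^+ 2 - 1)) ^+ k
       * ratr (euler_number (2 * k))
  = \sum_(k < n.+1)
     'C(n, k)%:R
       * ((lucas_balancing R[i] (2 * k)).[x] - s * (balancing R[i] (2 * k)).[x])
       * (6%:R * x * s) ^+ (n - k).
Proof.
pose t := 18%:R * x ^+ 2 - 1; pose y := 6%:R * x * s.
have y2 : 36%:R * x ^+ 2 * (9%:R * x ^+ 2 - 1) = y ^+ 2.
  by rewrite /y !exprMn hs; ring.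
have add2 : (3%:R * x + s) ^+ 2 = t + y by rewrite sqrrD hs /t /y; ring.
have sub2 : (3%:R * x - s) ^+ 2 = t - y by rewrite sqrrB hs /t /y; ring.
have -> : \sum_(k < n.+1) 'C(n, k)%:R
       * ((lucas_balancing R[i] (2 * k)).[x] - s * (balancing R[i] (2 * k)).[x])
       * (6%:R * x * s) ^+ (n - k) = t ^+ n.
  (* Writing t as y + (t - y), in this order, puts the exponent [n - k] on y; the Binet formulas
     turn the bracket into (t - y)^k. *)
  rewrite -[t in RHS](subrK y) addrC exprDn; apply: eq_bigr => k _.
  rewrite (lucas_balancing_binet hs) (balancing_binet hs) !exprM add2 sub2.
  by rewrite -mulr_natl -/y; field.
have two_neq0 : 2%:R != 0 :> R[i] by rewrite pnatr_eq0.
(* Doubling absorbs the 1/2 of the Binet formula; the vanishing odd Euler numbers then let the sum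
   over even indices run over all [j]. *)
apply: (mulIf two_neq0).
rewrite [RHS]mulr_natr -(euler_number_convolution t y) mulr_suml.
rewrite -(@big_ord_even _ (fun j => 'C(n, j)%:R
  * ((t + y) ^+ (n - j) + (t - y) ^+ (n - j)) * y ^+ j
  * ratr (euler_number j))); last first.
  by move=> j odd_j; rewrite euler_number_odd // rmorph0 mulr0.
apply: eq_bigr => k _.
rewrite (lucas_balancing_binet hs) y2 !exprM add2 sub2.
by field.
Qed.
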